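(* Let $a>1$ be fixed and let $g:[0,\infty)\to\mathbb{R}$ be twice differentiable with $g',g''\in C_w^k[0,\infty)$. Then for each $x\ge 0$, as $m\to\infty$, $$m\left|\hat{\mathcal{R}}_{m,a}(g;x)-g(x)-g'(x)\Lambda_{m,1}(x)-\frac{g''(x)}{2!}\Lambda_{m,2}(x)\right|=O(1)\,\Delta\!\left(g'';\sqrt{\tfrac{1}{m}}\right),$$ where $\Lambda_{m,j}(x)=\hat{\mathcal{R}}_{m,a}((t-x)^j;x)$ for $j=1,2$.
   Context: For fixed $a>1$, $m\in\mathbb{N}=\{1,2,\dots\}$ and $x\ge 0$, the modified Szász-Mirakjan-Kantorovich operators are $$\hat{\mathcal{R}}_{m,a}(f;x)=m\sum_{k=0}^{\infty}s_{m,k}^a(x)\int_{k/m}^{(k+1)/m}f(t)\,dt,\qquad s_{m,k}^a(x)=a^{-x/(a^{1/m}-1)}\,\frac{x^k(\log a)^k}{(a^{1/m}-1)^k\,k!},$$ with $\log$ the natural logarithm (and $0^0=1$). In $\hat{\mathcal{R}}_{m,a}((t-x)^j;x)$ the operator acts on the function $t\mapsto(t-x)^j$. Let $w(x)=1+x^2$. $B_w[0,\infty)$ is the set of functions $g:[0,\infty)\to\mathbb{R}$ with $|g(x)|\le M w(x)$ for all $x\ge0$, for some constant $M>0$ depending on $g$; $C_w[0,\infty)$ is the set of continuous $g\in B_w[0,\infty)$; and $C_w^k[0,\infty)$ is the set of $g\in C_w[0,\infty)$ for which $\lim_{x\to\infty}|g(x)|/w(x)$ exists and is finite (the superscript $k$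 is only part of the notation). For $g\in C_w^k[0,\infty)$ and $\xi>0$ the weighted modulus of continuity is $$\Delta(g;\xi)=\sup_{0\le h\le\xi,\ 0\le x<\infty}\frac{|g(x+h)-g(x)|}{(1+h^2)(1+x^2)}.$$ The symbol $O(1)$ denotes, for each fixed $x$, a quantity bounded in $m$ for all sufficiently large $m$. *)

(* Defs.v *)
From Stdlib Require Import Reals Factorial.
From Coquelicot Require Import Coquelicot.
Open Scope R_scope.

(* A function on [0, +oo) is represented by a total function R -> R; every
   definition below uses only its values on [0, +oo).  In particular the
   derivative at 0 is the one-sided one, obtained from [D_in] on [half_line]. *)
Definition half_line (x : R) : Prop := 0 <= x.

Definition w (x : R) : R := 1 + x ^ 2.

Definition B_w (g : R -> R) : Prop :=
  exists M : R, 0 < M /\ forall x : R, 0 <= x -> Rabs (g x) <= M * w x.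

Definition C_w (g : R -> R) : Prop :=
  B_w g /\ forall x : R, 0 <= x -> continue_in g half_line x.

(* The superscript k of the usual notation C_w^k is not a parameter. *)
Definition C_w_k (g : R -> R) : Prop :=
  C_w g /\ ex_finite_lim (fun x => Rabs (g x) / w x) p_infty.

(* For g in B_w and xi >= 0 the set is nonempty and bounded above, so that taking the real
   part of the extended least upper bound loses nothing. *)
Definition weighted_modulus (g : R -> R) (xi : R) : R :=
  real (Lub_Rbar (fun y : R =>
    exists h x : R, 0 <= h <= xi /\ 0 <= x /\
      y = Rabs (g (x + h) - g x) / ((1 + h ^ 2) * (1 + x ^ 2)))).

(* [Rpower a y] is the real power a^y (for a > 0), whereas [^] has exponent in
   nat and satisfies 0 ^ 0 = 1. *)
Definition basis (a : R) (m k : nat) (x : R) : R :=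
  let d := Rpower a (1 / INR m) - 1 in
  Rpower a (- x / d) * ((x ^ k * ln a ^ k) / (d ^ k * INR (fact k))).

Definition Rhat (a : R) (m : nat) (f : R -> R) (x : R) : R :=
  INR m * Series (fun k : nat =>
    basis a m k x * RInt f (INR k / INR m) (INR (S k) / INR m)).

Definition Lambda (a : R) (m j : nat) (x : R) : R :=
  Rhat a m (fun t => (t - x) ^ j) x.

(* Main.v *)
(** The weights [basis a m k x] are the Poisson probabilities of mean
    [lambda = x * ln a / (a^(1/m) - 1)], which lies within [x * ln a] of [m x].
    With [y = sqrt m * |t - x|], chaining steps of length [1 / sqrt m] bounds
    [|g''(t) - g''(x)|], hence by two mean value steps [m] times the Taylor
    remainder at [t], by a polynomial in [y] times [Delta (g''; 1 / sqrt m)], and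
    so by [const * Delta * exp y].  The exponential moments of the Poisson law at
    the scale [sqrt m] bound the operator on [exp y] uniformly in [m], so no
    central moment has to be computed. *)

Require Import Defs.
From Stdlib Require Import Reals Factorial Lra Lia.
From Coquelicot Require Import Coquelicot.
Open Scope R_scope.

(** * Calculus on the half line *)

Definition continuous_half_line (f : R -> R) : Prop :=
  forall t : R, 0 <= t -> continue_in f half_line t.

(** Extension by the constant [f 0] to the left of the origin: one-sided continuity at 0 becomes
    continuity on R, so that integration and mean value results for functions on R apply. *)
Definition clamp (f : R -> R) (t : R) : R := f (Rmax 0 t).

Lemma clamp_eq (f : R -> R) (t : R) : 0 <= t -> clamp f t = f t.
Proof. intros ht. unfold clamp. now rewrite Rmax_right. Qed.

Lemma continuity_pt_clamp (f : R -> R) (t : R) :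
  continuous_half_line f -> continuity_pt (clamp f) t.
Proof.
  intros hf eps heps.
  destruct (hf (Rmax 0 t) (Rmax_l 0 t) eps heps) as [alp [halp H]].
  exists alp. split; [exact halp|].
  intros s [_ hs]. simpl in hs |- *. unfold Rdist, clamp in *.
  (* The base point is excluded in [continue_in], and distinct [s] and [t] may clamp to the same
     point. In the other case [Rmax 0] does not increase distances. *)
  destruct (Req_dec (Rmax 0 s) (Rmax 0 t)) as [e|ne].
  - rewrite e, Rminus_diag, Rabs_R0. lra.
  - apply (H (Rmax 0 s)). repeat split.
    + apply Rmax_l.
    + now apply not_eq_sym.
    + simpl. unfold Rdist. revert hs. unfold Rmax, Rabs.
      destruct (Rle_dec 0 s), (Rle_dec 0 t);
        repeat destruct (Rcase_abs _); lra.
Qed.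

Lemma ex_RInt_half_line (f : R -> R) (u v : R) :
  continuous_half_line f -> 0 <= u <= v -> ex_RInt f u v.
Proof.
  intros hf huv.
  apply ex_RInt_ext with (clamp f).
  - intros t ht. rewrite Rmin_left in ht by lra. apply clamp_eq. lra.
  - apply (ex_RInt_continuous (V := R_CompleteNormedModule)). intros t _.
    apply continuity_pt_filterlim. now apply continuity_pt_clamp.
Qed.

Lemma D_in_continuous_half_line (f f' : R -> R) :
  (forall t : R, 0 <= t -> D_in f f' half_line t) -> continuous_half_line f.
Proof. intros h t ht. apply (cont_deriv f f'). now apply h. Qed.

Lemma D_in_is_derive (f f' : R -> R) (t : R) :
  D_in f f' half_line t -> 0 < t -> is_derive (clamp f) t (f' t).
Proof.
  intros h ht. apply is_derive_Reals. intros eps heps.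
  destruct (h eps heps) as [alp [halp H]].
  (* An increment smaller than [t] stays where [clamp f] and [f] agree. *)
  assert (hd : 0 < Rmin alp t) by now apply Rmin_pos.
  exists (mkposreal _ hd). intros k hk0 hk. simpl in hk.
  assert (hk1 : Rabs k < alp) by (apply Rlt_le_trans with (1 := hk), Rmin_l).
  assert (hk2 : Rabs k < t) by (apply Rlt_le_trans with (1 := hk), Rmin_r).
  apply Rabs_def2 in hk2.
  rewrite !clamp_eq by lra.
  specialize (H (t + k)). simpl in H. unfold Rdist in H.
  replace (t + k - t) with k in H by ring.
  apply H. unfold D_x, half_line. repeat split; lra.
Qed.

(** A kink of [clamp f] at 0 does no harm: differentiability is required only strictly between [u]
    and [v], hence at positive points. *)
Lemma MVT_half_line (f f' : R -> R) (u v : R) :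
  (forall t : R, 0 <= t -> D_in f f' half_line t) -> 0 <= u -> 0 <= v ->
  exists c : R, Rmin u v <= c <= Rmax u v /\ f v - f u = f' c * (v - u).
Proof.
  intros h hu hv.
  assert (h0 : 0 <= Rmin u v) by now apply Rmin_glb.
  destruct (MVT_gen (clamp f) u v f') as [c [hc e]].
  - intros t ht. apply D_in_is_derive; [apply h|]; lra.
  - intros t _. apply continuity_pt_clamp. now apply D_in_continuous_half_line with f'.
  - exists c. split; [exact hc|]. now rewrite !clamp_eq in e by lra.
Qed.

Lemma between_dist (u v c : R) : Rmin u v <= c <= Rmax u v -> Rabs (c - u) <= Rabs (v - u).
Proof.
  unfold Rmin, Rmax, Rabs. intros h.
  destruct (Rle_dec u v); repeat destruct (Rcase_abs _); lra.
Qed.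

(** The remainder and its derivative vanish at [x], and its second derivative is [g'' - g'' x], so
    two mean value steps suffice. The factor 1/2 of the Lagrange form is given up. *)
Lemma taylor2_remainder_bound (g g' g'' : R -> R) (x t B : R) :
  (forall s : R, 0 <= s -> D_in g g' half_line s) ->
  (forall s : R, 0 <= s -> D_in g' g'' half_line s) ->
  0 <= x -> 0 <= t ->
  (forall s : R, 0 <= s -> Rabs (s - x) <= Rabs (t - x) -> Rabs (g'' s - g'' x) <= B) ->
  Rabs (g t - g x - g' x * (t - x) - g'' x / 2 * (t - x) ^ 2) <= B * (t - x) ^ 2.
Proof.
  intros hg hg' hx ht hB.
  set (r := fun s => g s - g x - g' x * (s - x) - g'' x / 2 * (s - x) ^ 2).
  set (r' := fun s => g' s - g' x - g'' x * (s - x)).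
  assert (hr : forall s : R, 0 <= s -> D_in r r' half_line s).
  { intros s hs eps heps. destruct (hg s hs (eps / 2)) as [alp [halp H]]; [lra|].
    (* The quadratic term adds the error [g'' x / 2 * (v - s)] to the difference quotient; the
       radius [eps / A] keeps it within [eps / 2], and the added 1 makes [A] positive. *)
    set (A := Rabs (g'' x) + 1).
    assert (hA : 0 < A) by (unfold A; generalize (Rabs_pos (g'' x)); lra).
    exists (Rmin alp (eps / A)). split.
    { apply Rmin_pos; [exact halp|]. now apply Rdiv_lt_0_compat. }
    intros v [hv hd]. specialize (H v). simpl in *. unfold Rdist in *.
    assert (hne : v - s <> 0) by (destruct hv; lra).
    assert (h1 : Rabs ((g v - g s) / (v - s) - g' s) < eps / 2).
    { apply H. split; [exact hv|]. apply Rlt_le_trans with (1 := hd), Rmin_l. }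
    assert (h2 : Rabs (v - s) < eps / A).
    { apply Rlt_le_trans with (1 := hd), Rmin_r. }
    replace ((r v - r s) / (v - s) - r' s)
      with (((g v - g s) / (v - s) - g' s) + - (g'' x / 2 * (v - s)))
      by (unfold r, r'; field; exact hne).
    apply Rle_lt_trans with (1 := Rabs_triang _ _).
    rewrite Rabs_Ropp, Rabs_mult.
    assert (h3 : Rabs (g'' x / 2) <= A / 2).
    { unfold Rdiv. rewrite Rabs_mult, (Rabs_pos_eq (/ 2)) by lra. unfold A. lra. }
    assert (h4 : Rabs (g'' x / 2) * Rabs (v - s) <= A / 2 * (eps / A)).
    { apply Rmult_le_compat; try apply Rabs_pos; lra. }
    replace (A / 2 * (eps / A)) with (eps / 2) in h4 by (field; lra). lra. }
  assert (hr' : forall s, 0 <= s -> D_in r' (fun s => g'' s - g'' x) half_line s).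
  { intros s hs eps heps. destruct (hg' s hs eps heps) as [alp [halp H]].
    exists alp. split; [exact halp|].
    intros v hv. specialize (H v hv). simpl in *. unfold Rdist in *.
    destruct hv as [[_ hne] _].
    replace ((r' v - r' s) / (v - s) - (g'' s - g'' x))
      with ((g' v - g' s) / (v - s) - g'' s); [exact H|].
    unfold r'. field. lra. }
  (* [c] lies between [x] and [t], then [d] between [x] and [c], so [hB] applies at [d]. *)
  destruct (MVT_half_line r r' x t hr hx ht) as [c [hc ec]].
  assert (hc0 : 0 <= c) by (apply Rle_trans with (2 := proj1 hc); now apply Rmin_glb).
  destruct (MVT_half_line r' _ x c hr' hx hc0) as [d [hd ed]].
  assert (hd0 : 0 <= d) by (apply Rle_trans with (2 := proj1 hd); now apply Rmin_glb).
  apply between_dist in hc. apply between_dist in hd.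
  change (Rabs (r t) <= B * (t - x) ^ 2).
  replace (r t) with (r t - r x) by (unfold r; field).
  rewrite ec. replace (r' c) with (r' c - r' x) by (unfold r'; ring).
  rewrite ed, !Rabs_mult.
  assert (hb : Rabs (g'' d - g'' x) <= B) by (apply hB; lra).
  replace (B * (t - x) ^ 2) with (B * Rabs (t - x) * Rabs (t - x))
    by (rewrite <- (pow2_abs (t - x)); ring).
  apply Rmult_le_compat_r; [apply Rabs_pos|].
  apply Rmult_le_compat; try apply Rabs_pos; assumption.
Qed.

(** * The weighted modulus of continuity *)

(** [real] sends an infinite bound to 0, so the supremum must first be shown finite; membership in
    [B_w] provides this. *)
Lemma weighted_modulus_upper (f : R -> R) (xi h x : R) :
  B_w f -> 0 <= h <= xi -> 0 <= x ->
  Rabs (f (x + h) - f x) <= weighted_modulus f xi * ((1 + h ^ 2) * (1 + x ^ 2)).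
Proof.
  intros [M [hM hf]] hh hx. unfold weighted_modulus.
  set (E := fun y : R => _).
  assert (hden : forall h x : R, 0 < (1 + h ^ 2) * (1 + x ^ 2)) by (intros; nra).
  assert (hE : E (Rabs (f (x + h) - f x) / ((1 + h ^ 2) * (1 + x ^ 2))))
    by (exists h, x; tauto).
  destruct (Lub_Rbar_correct E) as [hub hleast].
  specialize (hub _ hE).
  (* The 3 comes from [(1 + (z + k)^2) + (1 + z^2) <= 3 (1 + k^2) (1 + z^2)]. *)
  assert (hb : Rbar_le (Lub_Rbar E) (3 * M)).
  { apply hleast. intros y (k & z & hk & hz & ->). simpl.
    apply Rle_div_l; [apply hden|].
    apply Rle_trans with (1 := Rabs_triang _ _). rewrite Rabs_Ropp.
    assert (h1 := hf (z + k) ltac:(lra)). assert (h2 := hf z hz). unfold w in *.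
    apply Rle_trans with (M * (1 + (z + k) ^ 2) + M * (1 + z ^ 2)); [lra|].
    rewrite <- Rmult_plus_distr_l, (Rmult_comm 3 M), !Rmult_assoc.
    apply Rmult_le_compat_l; [lra|]. nra. }
  destruct (Lub_Rbar E) as [l| |]; simpl in *; try contradiction.
  apply Rle_div_l in hub; [exact hub|apply hden].
Qed.

Lemma weighted_modulus_nonneg (f : R -> R) (xi : R) :
  B_w f -> 0 <= xi -> 0 <= weighted_modulus f xi.
Proof.
  intros hf hxi.
  assert (h := weighted_modulus_upper f xi 0 0 hf ltac:(lra) (Rle_refl 0)).
  rewrite Rplus_0_r, Rminus_diag, Rabs_R0 in h. lra.
Qed.

(** Induction on the number of steps. Each has length [h <= xi <= 1], so [1 + h^2 <= 2], and the
    weight at its left end is at most the weight at [v]. *)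
Lemma weighted_modulus_chain (f : R -> R) (xi : R) (n : nat) (u v : R) :
  B_w f -> 0 <= xi <= 1 -> 0 <= u -> u <= v <= u + INR n * xi ->
  Rabs (f v - f u) <= INR n * (2 * weighted_modulus f xi * (1 + v ^ 2)).
Proof.
  intros hf hxi hu. revert v.
  assert (hD : 0 <= weighted_modulus f xi) by (apply weighted_modulus_nonneg; tauto || lra).
  set (D := weighted_modulus f xi) in *.
  induction n as [|n IH]; intros v hv.
  - simpl in hv. replace v with u by lra. rewrite Rminus_diag, Rabs_R0. simpl. lra.
  (* The last step starts at [z]; the maximum keeps it from falling to the left of [u]. *)
  - rewrite S_INR in *. set (z := Rmax u (v - xi)).
    assert (hz : u <= z <= u + INR n * xi /\ v - xi <= z <= v).
    { assert (h := pos_INR n). unfold z. repeat split.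
      - apply Rmax_l.
      - apply Rmax_lub; nra.
      - apply Rmax_r.
      - apply Rmax_lub; lra. }
    assert (h1 := IH z (proj1 hz)).
    assert (h2 := weighted_modulus_upper f xi (v - z) z hf ltac:(lra) ltac:(lra)).
    fold D in h2. replace (z + (v - z)) with v in h2 by ring.
    assert (hzv : z ^ 2 <= v ^ 2) by (apply pow_incr; lra).
    assert (hh : (v - z) ^ 2 <= 1 ^ 2) by (apply pow_incr; lra).
    assert (h3 : D * ((1 + (v - z) ^ 2) * (1 + z ^ 2)) <= D * (2 * (1 + v ^ 2))).
    { apply Rmult_le_compat_l; [exact hD|].
      apply Rmult_le_compat; try lra; assert (h := pow2_ge_0 z);
        assert (h' := pow2_ge_0 (v - z)); lra. }
    assert (h4 : INR n * (2 * D * (1 + z ^ 2)) <= INR n * (2 * D * (1 + v ^ 2))).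
    { apply Rmult_le_compat_l; [apply pos_INR|]. apply Rmult_le_compat_l; lra. }
    replace (f v - f u) with ((f v - f z) + (f z - f u)) by ring.
    apply Rle_trans with (1 := Rabs_triang _ _). lra.
Qed.

(** With [n] the integer part of [y], [S n <= 1 + y] steps of length [/ q] join the two points.
    Since [q >= 1], both lie below [x + y], and [1 + (x + y)^2 <= 2 (1 + x^2) (1 + y^2)]; the 4 is
    this 2 times the 2 of the chain. *)
Lemma weighted_modulus_dist (f : R -> R) (q x s : R) :
  B_w f -> 1 <= q -> 0 <= x -> 0 <= s ->
  let y := q * Rabs (s - x) in
  Rabs (f s - f x) <= 4 * weighted_modulus f (/ q) * (1 + x ^ 2) * ((1 + y) * (1 + y ^ 2)).
Proof.
  intros hf hq hx hs y.
  assert (hq' : 0 <= / q <= 1).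
  { split; [left; apply Rinv_0_lt_compat; lra|].
    rewrite <- Rinv_1. apply Rinv_le_contravar; lra. }
  assert (hD := weighted_modulus_nonneg f (/ q) hf (proj1 hq')).
  set (D := weighted_modulus f (/ q)) in *.
  assert (hd := Rabs_pos (s - x)).
  assert (hy : 0 <= y) by (unfold y; nra).
  destruct (nfloor_ex y hy) as [n hn].
  assert (hxs : Rabs (s - x) <= INR (S n) * / q).
  { apply Rmult_le_reg_l with q; [lra|]. rewrite S_INR.
    replace (q * ((INR n + 1) * / q)) with (INR n + 1) by (field; lra).
    fold y. lra. }
  set (b := Rmax x s).
  assert (h1 : Rabs (f s - f x) <= INR (S n) * (2 * D * (1 + b ^ 2))).
  { unfold b. destruct (Rle_dec x s) as [l|l].
    - rewrite Rmax_right by lra. rewrite Rabs_pos_eq in hxs by lra.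
      apply weighted_modulus_chain; lra || assumption.
    - rewrite Rmax_left by lra. rewrite Rabs_minus_sym in hxs |- *.
      rewrite Rabs_pos_eq in hxs by lra.
      apply weighted_modulus_chain; lra || assumption. }
  assert (hb : 0 <= b <= x + y).
  { split; [apply Rle_trans with (1 := hx), Rmax_l|].
    apply Rmax_lub; [lra|].
    assert (h := Rle_abs (s - x)). assert (Rabs (s - x) <= y) by (unfold y; nra). lra. }
  assert (hb2 : b ^ 2 <= (x + y) ^ 2) by (apply pow_incr; lra).
  assert (hb3 : 1 + b ^ 2 <= 2 * ((1 + x ^ 2) * (1 + y ^ 2))).
  { assert (h := pow2_ge_0 (x - y)). assert (h' := pow2_ge_0 (x * y)). nra. }
  apply Rle_trans with (1 := h1).
  apply Rle_trans with ((1 + y) * (2 * D * (2 * ((1 + x ^ 2) * (1 + y ^ 2))))).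
  - apply Rmult_le_compat.
    + apply pos_INR.
    + assert (h := pow2_ge_0 b). apply Rmult_le_pos; lra.
    + rewrite S_INR. lra.
    + apply Rmult_le_compat_l; lra.
  - right. ring.
Qed.

(** * Elementary bounds on the exponential *)

Lemma exp_INR_mult (k : nat) (z : R) : exp (INR k * z) = exp z ^ k.
Proof.
  induction k as [|k IH].
  - simpl. now rewrite Rmult_0_l, exp_0.
  - rewrite S_INR, Rmult_plus_distr_r, Rmult_1_l, exp_plus, IH. simpl. ring.
Qed.

(** Fifth power of [1 + y <= 5 (1 + y/5) <= 5 exp (y/5)]. Five is the degree in [y] of the bound on
    the scaled Taylor remainder. *)
Lemma pow5_le_exp (y : R) : 0 <= y -> (1 + y) ^ 5 <= 3125 * exp y.
Proof.
  intros hy. replace (exp y) with (exp (y / 5) ^ 5)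
    by (rewrite <- exp_INR_mult; f_equal; simpl; field).
  replace 3125 with (5 ^ 5) by ring. rewrite <- Rpow_mult_distr.
  apply pow_incr. assert (h := exp_ineq1_le (y / 5)). lra.
Qed.

(** [exp z <= 1 / (1 - z)], while [(1 - z) (1 + z + 2 z^2) = 1 + z^2 (1 - 2 z) >= 1]. All negative
    [z] are covered, so the bound serves both tails. *)
Lemma exp_le_quadratic (z : R) : z <= 1 / 2 -> exp z <= 1 + z + 2 * z ^ 2.
Proof.
  intros hz. assert (h := exp_ineq1_le (- z)). rewrite exp_Ropp in h.
  assert (hp := exp_pos z).
  assert (h1 : (1 - z) * exp z <= 1).
  { apply Rmult_le_compat_r with (r := exp z) in h; [|lra].
    rewrite Rinv_l in h by lra. lra. }
  apply Rmult_le_reg_l with (1 - z); [lra|].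
  assert (h2 := pow2_ge_0 z). nra.
Qed.

(** * The Poisson weights and their exponential moments *)

Definition poisson_mean (a : R) (m : nat) (x : R) : R :=
  x * ln a / (Rpower a (1 / INR m) - 1).

Lemma Rpower_step_pos (a : R) (m : nat) :
  1 < a -> (0 < m)%nat -> 0 < Rpower a (1 / INR m) - 1.
Proof.
  intros ha hm. apply lt_0_INR in hm. apply Rlt_0_minus.
  apply Rle_lt_trans with (Rpower a 0); [rewrite Rpower_O; lra|].
  apply Rpower_lt; [exact ha|]. apply Rdiv_lt_0_compat; lra.
Qed.

Lemma basis_poisson (a : R) (m k : nat) (x : R) :
  1 < a -> (0 < m)%nat ->
  basis a m k x = exp (- poisson_mean a m x) * (poisson_mean a m x ^ k * / INR (fact k)).
Proof.
  intros ha hm. assert (hd := Rpower_step_pos a m ha hm).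
  unfold basis, poisson_mean. set (d := Rpower a (1 / INR m) - 1) in *.
  assert (hf := INR_fact_neq_0 k).
  assert (hdk : d ^ k <> 0) by (apply pow_nonzero; lra).
  unfold Rpower. f_equal.
  - f_equal. field. lra.
  - unfold Rdiv at 2. rewrite Rpow_mult_distr, pow_inv, Rpow_mult_distr. field. tauto.
Qed.

Lemma basis_nonneg (a : R) (m k : nat) (x : R) :
  1 < a -> (0 < m)%nat -> 0 <= x -> 0 <= basis a m k x.
Proof.
  intros ha hm hx. rewrite basis_poisson by assumption.
  assert (hd := Rpower_step_pos a m ha hm).
  assert (hl : 0 < ln a) by (rewrite <- ln_1; apply ln_increasing; lra).
  apply Rmult_le_pos; [left; apply exp_pos|].
  apply Rmult_le_pos; [|left; apply Rinv_0_lt_compat, INR_fact_lt_0].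
  apply pow_le. unfold poisson_mean. apply Rdiv_le_0_compat; [nra|exact hd].
Qed.

(** With [u = ln a / m] the mean is [m x u / (exp u - 1)], and [1 - u <= u / (exp u - 1) <= 1]
    follows from [1 + u <= exp u] and [1 - u <= exp (- u)]. *)
Lemma poisson_mean_bounds (a : R) (m : nat) (x : R) :
  1 < a -> (0 < m)%nat -> 0 <= x ->
  INR m * x - x * ln a <= poisson_mean a m x <= INR m * x.
Proof.
  intros ha hm hx. assert (hd := Rpower_step_pos a m ha hm).
  unfold poisson_mean. apply lt_0_INR in hm.
  assert (hu : ln a = INR m * (1 / INR m * ln a)) by (field; lra).
  unfold Rpower in *. set (u := 1 / INR m * ln a) in *.
  rewrite hu. set (d := exp u - 1) in *.
  assert (h1 := exp_ineq1_le u). assert (h2 := exp_ineq1_le (- u)).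
  rewrite exp_Ropp in h2. assert (hp := exp_pos u).
  assert (h3 : (1 - u) * exp u <= 1).
  { apply Rmult_le_compat_r with (r := exp u) in h2; [|lra].
    rewrite Rinv_l in h2 by lra. lra. }
  assert (hmx : 0 <= INR m * x) by nra.
  split.
  - apply Rle_div_r; [exact hd|].
    replace (INR m * x - x * (INR m * u)) with (INR m * x * (1 - u)) by ring.
    replace (x * (INR m * u)) with (INR m * x * u) by ring.
    rewrite Rmult_assoc. apply Rmult_le_compat_l; [exact hmx|]. unfold d. nra.
  - apply Rle_div_l; [exact hd|].
    replace (x * (INR m * u)) with (INR m * x * u) by ring.
    apply Rmult_le_compat_l; [exact hmx|]. unfold d. lra.
Qed.

(** The Poisson generating function: [b = exp th] yields exponential moments, [b = 1] the total
    mass. *)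
Lemma basis_generating (a : R) (m : nat) (x b : R) :
  1 < a -> (0 < m)%nat ->
  is_series (fun k => basis a m k x * b ^ k) (exp (poisson_mean a m x * (b - 1))).
Proof.
  intros ha hm. set (l := poisson_mean a m x).
  replace (exp (l * (b - 1))) with (scal (exp (- l)) (exp (l * b)))
    by (unfold scal; simpl; unfold mult; simpl; rewrite <- exp_plus; f_equal; ring).
  apply is_series_ext with
    (fun k => scal (exp (- l)) (scal (pow_n (l * b) k) (/ INR (fact k)))).
  - intros k. rewrite basis_poisson by assumption. fold l.
    rewrite pow_n_pow. unfold scal; simpl; unfold mult; simpl.
    rewrite Rpow_mult_distr. ring.
  - exact (is_series_scal (exp (- l)) _ _ (is_exp_Reals (l * b))).
Qed.

(** Two one-sided moments, each at most [exp (2 x + x ln a)], times the factor [exp 1] of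
    [exp_majorant]. It is independent of [m]. *)
Definition exp_moment_bound (a x : R) : R := 2 * exp (1 + 2 * x + x * ln a).

(** Dominates [exp (sqrt m |t - x|)] on the whole [k]-th cell. The sum [exp z + exp (- z)] replaces
    [exp |z|] because each summand has an explicit Poisson sum; [exp 1] pays for the cell width. *)
Definition exp_majorant (m : nat) (x : R) (k : nat) : R :=
  let z := / sqrt (INR m) * (INR k - INR m * x) in exp 1 * (exp z + exp (- z)).

(** In the exponent [- th m x + lambda (exp th - 1)], replacing [lambda] by [m x] costs at most
    [x ln a]. The quadratic bound on [exp th] then cancels the linear term and leaves
    [2 x m th^2 = 2 x]. *)
Lemma exp_moment_sided (a : R) (m : nat) (x th : R) :
  1 < a -> (0 < m)%nat -> 0 <= x -> th <= 1 / 2 -> INR m * th ^ 2 = 1 ->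
  exists l : R,
    is_series (fun k => basis a m k x * exp (th * (INR k - INR m * x))) l /\
    l <= exp (2 * x + x * ln a).
Proof.
  intros ha hm hx hth hmth.
  exists (exp (- (th * (INR m * x))) * exp (poisson_mean a m x * (exp th - 1))). split.
  - apply is_series_ext with
      (fun k => scal (exp (- (th * (INR m * x)))) (basis a m k x * exp th ^ k)).
    + intros k. rewrite <- exp_INR_mult. unfold scal; simpl; unfold mult; simpl.
      replace (th * (INR k - INR m * x)) with (INR k * th + - (th * (INR m * x))) by ring.
      rewrite exp_plus. ring.
    + exact (is_series_scal (exp (- (th * (INR m * x)))) _ _
        (basis_generating a m x (exp th) ha hm)).
  - rewrite <- exp_plus.
    destruct (poisson_mean_bounds a m x ha hm hx) as [h1 h2].
    assert (hl : 0 < ln a) by (rewrite <- ln_1; apply ln_increasing; lra).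
    assert (he := exp_le_quadratic th hth). assert (hp := exp_pos th).
    apply lt_0_INR in hm.
    assert (hxl : 0 <= x * ln a) by nra.
    assert (h3 : poisson_mean a m x * (exp th - 1)
                 <= INR m * x * (exp th - 1) + x * ln a).
    (* The sign of [exp th - 1] decides which bound on the mean is used; in the negative case
       [1 - exp th <= 1]. *)
    { destruct (Rle_dec 0 (exp th - 1)); nra. }
    assert (h4 : INR m * x * (exp th - 1) <= INR m * x * (th + 2 * th ^ 2)).
    { apply Rmult_le_compat_l; nra. }
    replace (INR m * x * (th + 2 * th ^ 2))
      with (th * (INR m * x) + 2 * x * (INR m * th ^ 2)) in h4 by ring.
    rewrite hmth in h4.
    destruct (Rle_lt_or_eq_dec
      (- (th * (INR m * x)) + poisson_mean a m x * (exp th - 1)) (2 * x + x * ln a))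
      as [hlt|heq]; [lra| |].
    + left. now apply exp_increasing.
    + right. now rewrite heq.
Qed.

Lemma exp_majorant_series (a : R) (m : nat) (x : R) :
  1 < a -> (4 <= m)%nat -> 0 <= x ->
  exists l : R,
    is_series (fun k => basis a m k x * exp_majorant m x k) l /\ l <= exp_moment_bound a x.
Proof.
  intros ha hm hx.
  assert (hm' : 4 <= INR m) by (apply le_INR in hm; simpl in hm; lra).
  set (q := sqrt (INR m)).
  assert (hq2 : q * q = INR m) by (apply sqrt_sqrt; lra).
  assert (hq : 2 <= q).
  { unfold q. replace 2 with (sqrt (2 * 2)) by (apply sqrt_square; lra).
    apply sqrt_le_1; lra. }
  (* Here [m >= 4] enters: [th = / q] must satisfy [th <= 1 / 2]. *)
  assert (hiq : 0 < / q <= 1 / 2).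
  { split; [apply Rinv_0_lt_compat; lra|].
    replace (1 / 2) with (/ 2) by field. apply Rinv_le_contravar; lra. }
  destruct (exp_moment_sided a m x (/ q)) as [l1 [hs1 hl1]]; try lra; try lia.
  { rewrite <- hq2. field. lra. }
  destruct (exp_moment_sided a m x (- / q)) as [l2 [hs2 hl2]]; try lra; try lia.
  { rewrite <- hq2. field. lra. }
  exists (exp 1 * (l1 + l2)). split.
  - apply is_series_ext with (fun k => scal (exp 1)
      (plus (basis a m k x * exp (/ q * (INR k - INR m * x)))
            (basis a m k x * exp (- / q * (INR k - INR m * x))))).
    + intros k. unfold exp_majorant. fold q. rewrite Ropp_mult_distr_l.
      unfold scal, plus; simpl; unfold mult; simpl. ring.
    + exact (is_series_scal (exp 1) _ _ (is_series_plus _ _ _ _ hs1 hs2)).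
  - unfold exp_moment_bound. rewrite Rplus_assoc, exp_plus. assert (h := exp_pos 1). nra.
Qed.

(** [sqrt m (t - x)] exceeds [z] by [(m t - k) / sqrt m], which lies in [0, 1] on the cell. *)
Lemma exp_dist_le_majorant (m k : nat) (x t : R) :
  (0 < m)%nat -> INR k / INR m <= t <= INR (S k) / INR m ->
  exp (sqrt (INR m) * Rabs (t - x)) <= exp_majorant m x k.
Proof.
  intros hm ht. rewrite S_INR in ht.
  assert (hm1 : 1 <= INR m) by (apply (le_INR 1); lia).
  set (q := sqrt (INR m)).
  assert (hq2 : q * q = INR m) by (apply sqrt_sqrt; lra).
  assert (hq : 1 <= q) by (unfold q; rewrite <- sqrt_1; apply sqrt_le_1; lra).
  assert (hiq : 0 < / q <= 1).
  { split; [apply Rinv_0_lt_compat; lra|].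
    rewrite <- Rinv_1. apply Rinv_le_contravar; lra. }
  unfold exp_majorant. fold q. set (z := / q * (INR k - INR m * x)).
  assert (e : q * (t - x) = z + / q * (INR m * t - INR k))
    by (unfold z; rewrite <- hq2; field; lra).
  assert (h1 : 0 <= INR m * t - INR k <= 1).
  { destruct ht as [ha hb]. apply Rle_div_l in ha; [|lra]. apply Rle_div_r in hb; lra. }
  assert (h2 : 0 <= / q * (INR m * t - INR k) <= 1) by nra.
  rewrite <- (Rabs_pos_eq q) at 1 by lra. rewrite <- Rabs_mult, e.
  set (v := / q * (INR m * t - INR k)) in *.
  assert (hmono : forall u v, u <= v -> exp u <= exp v).
  { intros u w [hlt|heq]; [left; now apply exp_increasing|right; now rewrite heq]. }
  rewrite Rmult_plus_distr_l, <- !exp_plus.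
  assert (p1 := exp_pos (1 + z)). assert (p2 := exp_pos (1 + - z)).
  unfold Rabs. destruct (Rcase_abs (z + v)).
  - assert (h := hmono (- (z + v)) (1 + - z)). lra.
  - assert (h := hmono (z + v) (1 + z)). lra.
Qed.

(** * Bounds for the operator *)

Definition exp_bounded (m : nat) (x M : R) (f : R -> R) : Prop :=
  forall t : R, 0 <= t -> Rabs (f t) <= M * exp (sqrt (INR m) * Rabs (t - x)).

Definition Rhat_term (a : R) (m : nat) (f : R -> R) (x : R) (k : nat) : R :=
  basis a m k x * RInt f (INR k / INR m) (INR (S k) / INR m).

Lemma cell_bounds (m k : nat) :
  (0 < m)%nat -> 0 <= INR k / INR m <= INR (S k) / INR m.
Proof.
  intros hm. apply lt_0_INR in hm. assert (hk := pos_INR k). split.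
  - now apply Rdiv_le_0_compat.
  - apply Rmult_le_compat_r; [left; now apply Rinv_0_lt_compat|]. rewrite S_INR. lra.
Qed.

(** The cell length [1 / m] cancels the leading factor [m], and the majorant is summed against the
    weights. Convergence is part of the conclusion because [Series] has a value even on divergent
    series, while linearity requires convergence. *)
Lemma Rhat_bound (a : R) (m : nat) (x M : R) (f : R -> R) :
  1 < a -> (4 <= m)%nat -> 0 <= x -> 0 <= M ->
  continuous_half_line f -> exp_bounded m x M f ->
  ex_series (Rhat_term a m f x) /\ Rabs (Rhat a m f x) <= M * exp_moment_bound a x.
Proof.
  intros ha hm hx hM hc hf.
  destruct (exp_majorant_series a m x ha hm hx) as [l [hs hl]].
  assert (hm0 : (0 < m)%nat) by lia.
  assert (hmp := lt_0_INR m hm0).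
  assert (hterm : forall k,
    Rabs (Rhat_term a m f x k) <= M / INR m * (basis a m k x * exp_majorant m x k)).
  { intros k. unfold Rhat_term.
    assert (hb := basis_nonneg a m k x ha hm0 hx).
    rewrite Rabs_mult, (Rabs_pos_eq (basis _ _ _ _)) by exact hb.
    destruct (cell_bounds m k hm0) as [hk hk'].
    assert (hint : Rabs (RInt f (INR k / INR m) (INR (S k) / INR m))
      <= (INR (S k) / INR m - INR k / INR m) * (M * exp_majorant m x k)).
    { apply abs_RInt_le_const; [exact hk'| now apply ex_RInt_half_line |].
      intros t ht. apply Rle_trans with (1 := hf t ltac:(lra)).
      apply Rmult_le_compat_l; [exact hM|]. now apply exp_dist_le_majorant. }
    apply Rmult_le_compat_l with (r := basis a m k x) in hint; [|exact hb].
    apply Rle_trans with (1 := hint). right. rewrite S_INR. field. lra. }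
  assert (hs' := is_series_scal (M / INR m) _ _ hs).
  assert (hex : ex_series (fun k => Rabs (Rhat_term a m f x k))).
  { apply (ex_series_le (K := R_AbsRing) (V := R_CompleteNormedModule)) with
      (fun k => scal (M / INR m) (basis a m k x * exp_majorant m x k)).
    - intros k. unfold norm; simpl. unfold abs; simpl. rewrite Rabs_Rabsolu. apply hterm.
    - eexists. exact hs'. }
  split; [now apply ex_series_Rabs|].
  unfold Rhat. fold (Rhat_term a m f x).
  rewrite Rabs_mult, (Rabs_pos_eq (INR m)) by lra.
  assert (h1 : Rabs (Series (Rhat_term a m f x)) <= M / INR m * l).
  { apply Rle_trans with (1 := Series_Rabs _ hex).
    apply Rle_trans with (Series (fun k =>
      scal (M / INR m) (basis a m k x * exp_majorant m x k))).
    - apply Series_le; [|eexists; exact hs'].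
      intros k. split; [apply Rabs_pos|apply hterm].
    - right. now apply is_series_unique. }
  apply Rle_trans with (INR m * (M / INR m * l)).
  - apply Rmult_le_compat_l; lra.
  - replace (INR m * (M / INR m * l)) with (M * l) by (field; lra).
    now apply Rmult_le_compat_l.
Qed.

(** Total mass one times the cell length; [Rhat_term] omits the factor [m]. *)
Lemma Rhat_one (a : R) (m : nat) (x : R) :
  1 < a -> (0 < m)%nat -> is_series (Rhat_term a m (fun _ => 1) x) (/ INR m).
Proof.
  intros ha hm. assert (hmp := lt_0_INR m hm).
  assert (h := is_series_scal (/ INR m) _ _ (basis_generating a m x 1 ha hm)).
  rewrite Rminus_diag, Rmult_0_r, exp_0 in h.
  rewrite <- (Rmult_1_r (/ INR m)).
  revert h. apply is_series_ext. intros k.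
  unfold Rhat_term. rewrite RInt_const, S_INR, pow1.
  unfold scal; simpl; unfold mult; simpl. field. lra.
Qed.

(** * Powers, the Taylor remainder and linearity *)

Lemma continuity_half_line (f : R -> R) : continuity f -> continuous_half_line f.
Proof.
  intros hf t _ eps heps. destruct (hf t eps heps) as [alp [halp H]].
  exists alp. split; [exact halp|]. intros s [[_ hne] hs]. apply H.
  split; [split; [exact I|exact hne]|exact hs].
Qed.

Lemma continuous_power_dist (x : R) (j : nat) :
  continuous_half_line (fun t => (t - x) ^ j).
Proof. apply continuity_half_line. intros t. reg. Qed.

Lemma exp_bounded_power_dist (m : nat) (x : R) (j : nat) :
  (1 <= m)%nat -> (j <= 5)%nat -> exp_bounded m x 3125 (fun t => (t - x) ^ j).
Proof.
  intros hm hj t ht.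
  assert (hq : 1 <= sqrt (INR m)).
  { apply le_INR in hm. simpl in hm. rewrite <- sqrt_1. apply sqrt_le_1; lra. }
  set (q := sqrt (INR m)) in *. assert (hd := Rabs_pos (t - x)).
  apply Rle_trans with (2 := pow5_le_exp (q * Rabs (t - x)) ltac:(nra)).
  rewrite <- RPow_abs.
  apply Rle_trans with ((1 + q * Rabs (t - x)) ^ j).
  - apply pow_incr. nra.
  - apply Rle_pow; [nra|exact hj].
Qed.

(** The modulus estimate grows with the distance to [x], so its value at [t] serves for every [s] no
    farther away. The constant is 12500 = 4 * 3125. *)
Lemma taylor_exp_bounded (g g' g'' : R -> R) (m : nat) (x : R) :
  (forall s : R, 0 <= s -> D_in g g' half_line s) ->
  (forall s : R, 0 <= s -> D_in g' g'' half_line s) ->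
  B_w g'' -> (1 <= m)%nat -> 0 <= x ->
  exp_bounded m x (12500 * (1 + x ^ 2) * weighted_modulus g'' (sqrt (1 / INR m)) / INR m)
    (fun t => g t - g x - g' x * (t - x) - g'' x / 2 * (t - x) ^ 2).
Proof.
  intros hg hg' hB hm hx t ht.
  assert (hm1 : 1 <= INR m) by (apply le_INR in hm; exact hm).
  assert (exi : sqrt (1 / INR m) = / sqrt (INR m)).
  { unfold Rdiv. rewrite Rmult_1_l. apply sqrt_inv. }
  rewrite exi. set (q := sqrt (INR m)).
  assert (hq2 : q * q = INR m) by (apply sqrt_sqrt; lra).
  assert (hq : 1 <= q) by (unfold q; rewrite <- sqrt_1; apply sqrt_le_1; lra).
  assert (hD : 0 <= weighted_modulus g'' (/ q)).
  { apply weighted_modulus_nonneg; [exact hB|]. left. apply Rinv_0_lt_compat. lra. }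
  set (D := weighted_modulus g'' (/ q)) in *.
  set (y := q * Rabs (t - x)).
  assert (hy : 0 <= y) by (unfold y; assert (h := Rabs_pos (t - x)); nra).
  assert (hx2 := pow2_ge_0 x).
  apply Rle_trans with
    (4 * D * (1 + x ^ 2) * ((1 + y) * (1 + y ^ 2)) * (t - x) ^ 2).
  - apply (taylor2_remainder_bound g g' g''); try assumption.
    intros s hs hsx.
    apply Rle_trans with (1 := weighted_modulus_dist g'' q x s hB hq hx hs).
    fold D. assert (hp := Rabs_pos (s - x)).
    set (v := q * Rabs (s - x)).
    assert (hv : 0 <= v <= y) by (unfold v, y; split; [nra|apply Rmult_le_compat_l; lra]).
    assert (hv2 : v ^ 2 <= y ^ 2) by now apply pow_incr.
    apply Rmult_le_compat_l; [apply Rmult_le_pos; lra|].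
    assert (h0 := pow2_ge_0 v). apply Rmult_le_compat; lra.
  (* The square of the distance, rescaled to [y], supplies the factor [1 / m]. *)
  - assert (ey : (t - x) ^ 2 = y ^ 2 / INR m).
    { unfold y. rewrite Rpow_mult_distr, pow2_abs, <- hq2. field. lra. }
    rewrite ey. assert (h5 := pow5_le_exp y hy).
    assert (h6 : (1 + y) * (1 + y ^ 2) * y ^ 2 <= (1 + y) ^ 5).
    { assert (h0 := pow2_ge_0 y).
      replace ((1 + y) ^ 5) with ((1 + y) * (1 + y) ^ 2 * (1 + y) ^ 2) by ring.
      apply Rmult_le_compat; try nra. }
    replace (4 * D * (1 + x ^ 2) * ((1 + y) * (1 + y ^ 2)) * (y ^ 2 / INR m))
      with (4 * (1 + x ^ 2) * D / INR m * ((1 + y) * (1 + y ^ 2) * y ^ 2)) by (field; lra).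
    replace (12500 * (1 + x ^ 2) * D / INR m * exp y)
      with (4 * (1 + x ^ 2) * D / INR m * (3125 * exp y)) by (field; lra).
    apply Rmult_le_compat_l; [|lra].
    apply Rdiv_le_0_compat; [|lra]. repeat apply Rmult_le_pos; lra.
Qed.

Lemma continue_in_lincomb (f h : R -> R) (c : R) :
  continuous_half_line f -> continuous_half_line h ->
  continuous_half_line (fun t => f t - c * h t).
Proof.
  intros hf hh t ht. apply limit_minus; [now apply hf|].
  apply limit_mul; [apply (limit_free (fun _ => _) _ 0)|now apply hh].
Qed.

(** Convergence for [g] is derived, without a growth estimate on [g]: it is the sum of the series
    for [r], for the constant and for the two powers. *)
Lemma Rhat_taylor (a : R) (m : nat) (x c0 c1 c2 : R) (g : R -> R) :
  1 < a -> (4 <= m)%nat -> 0 <= x -> continuous_half_line g ->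
  let r := fun t => g t - c0 - c1 * (t - x) - c2 * (t - x) ^ 2 in
  ex_series (Rhat_term a m r x) ->
  Rhat a m r x = Rhat a m g x - c0 - c1 * Lambda a m 1 x - c2 * Lambda a m 2 x.
Proof.
  intros ha hm hx hg r hr.
  assert (hm0 : (0 < m)%nat) by lia. assert (hmp := lt_0_INR m hm0).
  set (p := fun (j : nat) t => (t - x) ^ j).
  assert (hp : forall j, (j <= 5)%nat -> ex_series (Rhat_term a m (p j) x)).
  { intros j hj. apply (Rhat_bound a m x 3125 (p j)); try assumption; try lra.
    - apply continuous_power_dist.
    - apply exp_bounded_power_dist; lia. }
  assert (h1 := Rhat_one a m x ha hm0).
  assert (hp1 := Series_correct _ (hp 1%nat ltac:(lia))).
  assert (hp2 := Series_correct _ (hp 2%nat ltac:(lia))).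
  assert (hr' := Series_correct _ hr).
  assert (hsum := is_series_plus _ _ _ _ hr'
    (is_series_plus _ _ _ _ (is_series_scal c0 _ _ h1)
      (is_series_plus _ _ _ _ (is_series_scal c1 _ _ hp1) (is_series_scal c2 _ _ hp2)))).
  assert (hg' : is_series (Rhat_term a m g x)
    (Series (Rhat_term a m r x) + (c0 * / INR m + (c1 * Series (Rhat_term a m (p 1%nat) x)
       + c2 * Series (Rhat_term a m (p 2%nat) x))))).
  { revert hsum. apply is_series_ext. intros k. unfold Rhat_term.
    set (u := INR k / INR m). set (v := INR (S k) / INR m).
    assert (huv : 0 <= u <= v) by now apply cell_bounds.
    assert (i0 := RInt_correct _ _ _ (ex_RInt_half_line g u v hg huv)).
    assert (i1 := RInt_correct _ _ _
      (ex_RInt_half_line (p 1%nat) u v (continuous_power_dist x 1) huv)).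
    assert (i2 := RInt_correct _ _ _
      (ex_RInt_half_line (p 2%nat) u v (continuous_power_dist x 2) huv)).
    assert (ic := is_RInt_const (V := R_NormedModule) u v 1).
    (* On each cell [r] is integrated as [g] minus the quadratic polynomial. *)
    assert (ir := is_RInt_minus _ _ _ _ _ _ i0
      (is_RInt_plus _ _ _ _ _ _ (is_RInt_scal _ _ _ c0 _ ic)
        (is_RInt_plus _ _ _ _ _ _ (is_RInt_scal _ _ _ c1 _ i1)
          (is_RInt_scal _ _ _ c2 _ i2)))).
    assert (er : RInt r u v = minus (RInt g u v)
      (plus (scal c0 (scal (v - u) 1))
        (plus (scal c1 (RInt (p 1%nat) u v)) (scal c2 (RInt (p 2%nat) u v))))).
    { apply is_RInt_unique. revert ir. apply is_RInt_ext. intros t _.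
      unfold r, p, minus, plus, opp, scal; simpl; unfold mult; simpl. ring. }
    rewrite er, RInt_const.
    unfold minus, plus, opp, scal; simpl; unfold mult; simpl. ring. }
  apply is_series_unique in hg'.
  change (INR m * Series (Rhat_term a m r x) = INR m * Series (Rhat_term a m g x) - c0
    - c1 * (INR m * Series (Rhat_term a m (p 1%nat) x))
    - c2 * (INR m * Series (Rhat_term a m (p 2%nat) x))).
  rewrite hg'. field. lra.
Qed.

(** * The asymptotic estimate *)

Theorem theorem4p1 (a : R) (ha : 1 < a) (g g' g'' : R -> R)
    (hg' : forall x : R, 0 <= x -> D_in g g' half_line x)
    (hg'' : forall x : R, 0 <= x -> D_in g' g'' half_line x)
    (hCg' : C_w_k g') (hCg'' : C_w_k g'') (x : R) (hx : 0 <= x) :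
  exists C : R, eventually (fun m : nat =>
    INR m * Rabs (Rhat a m g x - g x - g' x * Lambda a m 1 x
                  - g'' x / INR (fact 2) * Lambda a m 2 x)
    <= C * weighted_modulus g'' (sqrt (1 / INR m))).
Proof.
  (* The remainder constant times the moment bound; the [1 / m] in the former absorbs the factor [m]
     of the claim. *)
  exists (12500 * (1 + x ^ 2) * exp_moment_bound a x).
  exists 4%nat. intros m hm.
  assert (hmp : 0 < INR m) by (apply lt_0_INR; lia).
  destruct hCg'' as [[hB _] _].
  replace (INR (fact 2)) with 2 by (simpl; ring).
  set (D := weighted_modulus g'' (sqrt (1 / INR m))).
  assert (hD : 0 <= D) by (apply weighted_modulus_nonneg; [exact hB|apply sqrt_pos]).
  assert (hx2 := pow2_ge_0 x).
  pose proof (D_in_continuous_half_line g g' hg') as hcg.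
  assert (hcr : continuous_half_line
    (fun t => g t - g x - g' x * (t - x) - g'' x / 2 * (t - x) ^ 2)).
  { intros t ht.
    apply (continue_in_lincomb (fun t => g t - g x - g' x * (t - x))
      (fun t => (t - x) ^ 2)); [|apply continuous_power_dist|exact ht].
    apply (continue_in_lincomb (fun t => g t - g x) (fun t => t - x)).
    - intros s hs. apply limit_minus; [now apply hcg|apply (limit_free (fun _ => _) _ 0)].
    - apply continuity_half_line. intros s. reg. }
  destruct (Rhat_bound a m x (12500 * (1 + x ^ 2) * D / INR m)
    (fun t => g t - g x - g' x * (t - x) - g'' x / 2 * (t - x) ^ 2) ha hm hx)
    as [hex hbd].
  - apply Rdiv_le_0_compat; [|exact hmp]. repeat apply Rmult_le_pos; lra.
  - exact hcr.
  - apply (taylor_exp_bounded g g' g''); assumption || lia.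
  (* The error is the operator applied to the Taylor remainder, by linearity; [hex] gives the
     required convergence. *)
  - rewrite <- Rhat_taylor by assumption.
    apply Rmult_le_compat_l with (r := INR m) in hbd; [|lra].
    apply Rle_trans with (1 := hbd). right. field. lra.
Qed.
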